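(* Suppose $p\in \mathbb{C}[z_1,\dots,z_n]$ is stable. If $p(0)=1$, then for all $z\in\mathbb{C}^n$, \[ |p(z)| \leq \exp\left( \sqrt{2}\,|\nabla p(0)|\,|z| +\left(|\nabla p(0)|^2+\|\operatorname{Re} Hp(0)\|\right)|z|^2\right). \]
   Context: A polynomial $p\in\mathbb{C}[z_1,\dots,z_n]$ is called stable if it has no zeros in $(\mathbb{C}_+)^n$, where $\mathbb{C}_+=\{z\in\mathbb{C}:\operatorname{Im} z>0\}$. Here $\nabla p(0)=(\partial p/\partial z_1(0),\dots,\partial p/\partial z_n(0))\in\mathbb{C}^n$, $|\cdot|$ is the Euclidean norm on $\mathbb{C}^n$, $Hp(0)$ is the Hessian matrix $\left(\partial^2p/\partial z_j\partial z_k(0)\right)_{j,k}$, $\operatorname{Re} Hp(0)$ is its entrywise real part (which, as $Hp(0)$ is symmetric, equals $\frac12(Hp(0)+Hp(0)^* )$), and $\|\cdot\|$ is the operator norm. *)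

(* Defs.v *)
From mathcomp Require Import all_boot all_order all_algebra complex.
From mathcomp Require Import classical_sets reals.
(* Not imported: the notations of mpoly clash with those of MathComp-Analysis. *)
From mathcomp Require mpoly.

Set Implicit Arguments.
Unset Strict Implicit.
Unset Printing Implicit Defensive.

Import Order.TTheory GRing.Theory Num.Theory.

Local Open Scope ring_scope.

Definition peval (R : realType) (n : nat)
    (p : mpoly.mpoly n R[i]) (z : 'cV[R[i]]_n) : R[i] :=
  mpoly.meval (fun j => z j 0) p.

Definition stable (R : realType) (n : nat) (p : mpoly.mpoly n R[i]) : Prop :=
  forall z : 'cV[R[i]]_n,
    (forall j, 0 < complex.Im (z j 0)) -> peval p z <> 0.

Definition gradient (R : realType) (n : nat)
    (p : mpoly.mpoly n R[i]) (z : 'cV[R[i]]_n) : 'cV[R[i]]_n :=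
  \col_j peval (mpoly.mderiv j p) z.

Definition hessian (R : realType) (n : nat)
    (p : mpoly.mpoly n R[i]) (z : 'cV[R[i]]_n) : 'M[R[i]]_n :=
  \matrix_(j, k) peval (mpoly.mderiv j (mpoly.mderiv k p)) z.

(* The entrywise real part, still regarded as a matrix acting on C^n. *)
Definition remx (R : realType) (m n : nat) (A : 'M[R[i]]_(m, n)) :
    'M[R[i]]_(m, n) :=
  map_mx (fun x => real_complex R (complex.Re x)) A.

(* The norm that MathComp-Analysis puts on matrices is the sup norm, so the
   Euclidean norm and the operator norm it induces are defined here. *)
Definition l2norm (R : realType) (n : nat) (v : 'cV[R[i]]_n) : R :=
  Num.sqrt (\sum_j Normc.normc (v j 0) ^+ 2).

Definition opnorm (R : realType) (m n : nat) (A : 'M[R[i]]_(m, n)) : R :=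
  sup [set l2norm (A *m v) | v in [set v : 'cV[R[i]]_n | l2norm v <= 1]]%classic.

(* Main.v *)
Require Import Defs.
From mathcomp Require Import all_boot all_order all_algebra complex.
From mathcomp Require Import classical_sets reals sequences exp.
From mathcomp Require mpoly.
From mathcomp Require Import functions topology normedtype derive.
From mathcomp Require Import ring lra.
Import -(notations) mpoly.

(** Write H for the open upper half-plane and N_j = - (d_j p) / p.  Along the
    ray through z the logarithm of |p (t z)| grows at the rate
    - Re (\sum_j z_j N_j (t z)), so everything depends on how far N_j (t z) can
    move away from N_j 0.

    For stable p the functions N_j map H^n into the closed upper half-plane,
    because all the roots of t |-> p (z + t e_j) lie strictly below the real
    axis.  A function with this property is rigid near a boundary point, by
    Julia's lemma: if f maps H into the closed half-plane and is real
    at 0, then |f z - f 0| ^ 2 <= Im (f z) f'(0) |z| ^ 2 / Im z.  Lemma [julia]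
    is the analogue for N_j in n variables; it confines N_j (t z) to a disc
    that only involves the first and second derivatives of p at 0.  Since N_j 0
    need not be real, it is applied not to p but to the polynomial a + xi b in
    n + 1 variables, where p = a + i b splits p into real and imaginary
    coefficients; this polynomial is stable, has real coefficients, and is p
    at xi = i.

    Julia's lemma itself reduces to polynomials r in one variable without roots
    in H: then Im (- r'(0) / r(0)) = \sum Im (1 / root) is nonnegative, and is
    at least 1 when - i is one of the roots.  The variables z_k are made to
    depend on a single t through real Moebius maps that fix 0 and send i to z_k,
    and r is obtained from (d_j p) + eta p, where the number eta is chosen so
    as to produce a root at - i ([real_pencil]).

    A Gronwall argument then integrates the rate of growth and gives
    [stable_cabs2_bound]: with z_j = x_j + i y_j, u_k = |z_k| ^ 2 / y_k
    and v_j = y_j + |z_j|, log |p z| is at most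
      \sum_j (Re (d_j p) 0 x_j - Im (d_j p) 0 v_j / 2)
      + (1 / 4) \sum_(j, k) u_k K_jk v_j,
    where K_jk = Re (d_j p) 0 Re (d_k p) 0 - Re (d_k d_j p) 0.  Finally,
    for a general z, the modulus of p grows when the imaginary
    parts of the coordinates are made positive and larger
    ([stable_cabs2_le]).  Raising every argument to at least 30 degrees
    ([elevation_exists]) makes |u| |v| <= 4 |z| ^ 2 and turns the last
    bound into the theorem through Cauchy-Schwarz. *)

Set Implicit Arguments.
Unset Strict Implicit.
Unset Printing Implicit Defensive.

Import Order.TTheory GRing.Theory Num.Theory.
Import numFieldNormedType.Exports.

Local Open Scope ring_scope.
Local Notation Re := complex.Re.
Local Notation Im := complex.Im.

(** * Complex numbers in coordinates, and polynomials without roots in the upper half-plane *)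

Section ComplexCoordinates.
Variable R : realType.
Implicit Types x y : R[i].

Definition cabs2 x : R := Re x ^+ 2 + Im x ^+ 2.

Lemma complex_ext x y : Re x = Re y -> Im x = Im y -> x = y.
Proof. by case: x => a b; case: y => c d /= -> ->. Qed.

Lemma Re_add x y : Re (x + y) = Re x + Re y. Proof. by case: x; case: y. Qed.
Lemma Im_add x y : Im (x + y) = Im x + Im y. Proof. by case: x; case: y. Qed.
Lemma Re_opp x : Re (- x) = - Re x. Proof. by case: x. Qed.
Lemma Im_opp x : Im (- x) = - Im x. Proof. by case: x. Qed.
Lemma Re_mul x y : Re (x * y) = Re x * Re y - Im x * Im y.
Proof. by case: x; case: y. Qed.
Lemma Im_mul x y : Im (x * y) = Re x * Im y + Im x * Re y.
Proof. by case: x; case: y. Qed.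
Lemma Re_conjc x : Re (conjc x) = Re x. Proof. by case: x. Qed.
Lemma Im_conjc x : Im (conjc x) = - Im x. Proof. by case: x. Qed.

Definition cE := (Re_add, Im_add, Re_opp, Im_opp, Re_mul, Im_mul, Re_conjc, Im_conjc).

Lemma Re_sum (I : Type) (r : seq I) (P : pred I) (F : I -> R[i]) :
  Re (\sum_(i <- r | P i) F i) = \sum_(i <- r | P i) Re (F i).
Proof. by apply: (big_morph (@Re R)) => // x y; rewrite Re_add. Qed.

Lemma Im_sum (I : Type) (r : seq I) (P : pred I) (F : I -> R[i]) :
  Im (\sum_(i <- r | P i) F i) = \sum_(i <- r | P i) Im (F i).
Proof. by apply: (big_morph (@Im R)) => // x y; rewrite Im_add. Qed.

Lemma cabs2_ge0 x : 0 <= cabs2 x.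
Proof. by rewrite addr_ge0 ?sqr_ge0. Qed.

Lemma cabs2_eq0 x : (cabs2 x == 0) = (x == 0).
Proof. by rewrite paddr_eq0 ?sqr_ge0 // !sqrf_eq0 eq_complex. Qed.

Lemma cabs2_gt0 x : (0 < cabs2 x) = (x != 0).
Proof. by rewrite lt_def cabs2_ge0 andbT cabs2_eq0. Qed.

Lemma cabs2M x y : cabs2 (x * y) = cabs2 x * cabs2 y.
Proof. by rewrite /cabs2 !cE; ring. Qed.

Lemma cabs2_conj x : cabs2 (conjc x) = cabs2 x.
Proof. by rewrite /cabs2 !cE; ring. Qed.

Lemma normc_cabs2 x : Normc.normc x = Num.sqrt (cabs2 x).
Proof. by case: x. Qed.

Lemma normc_sqr x : Normc.normc x ^+ 2 = cabs2 x.
Proof. by rewrite normc_cabs2 sqr_sqrtr ?cabs2_ge0. Qed.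

End ComplexCoordinates.

Section NoRootsAbove.
Variable R : realType.
Implicit Types r : {poly R[i]}.

Definition upper_stable r := forall z : R[i], 0 < Im z -> r.[z] != 0.

(** This is Im (- r'(0) / r(0)) |r(0)| ^ 2, that is, |r(0)| ^ 2 times the sum of
    Im (1 / x) over the roots x of r, in a form that needs no division. *)
Definition logslope r := Im (- r^`().[0] * conjc r.[0]).

(** Over an algebraically closed field such a polynomial is a constant times a
    product of factors 'X - x with Im x <= 0. *)
Lemma upper_stable_ind (Q : {poly R[i]} -> Prop) :
    (forall c, Q c%:P) ->
    (forall r z, Im z <= 0 -> Q r -> Q (('X - z%:P) * r)) ->
  forall r, upper_stable r -> Q r.
Proof.
move=> Qc QM r rP; have [s rE] := closed_field_poly_normal r.
have : all (fun z : R[i] => Im z <= 0) s.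
  apply/allP => z zs; rewrite leNgt; apply/negP => /rP.
  rewrite rE hornerZ horner_prod mulf_eq0 negb_or => /andP[_].
  by rewrite prodf_seq_neq0 => /allP /(_ _ zs); rewrite !hornerE subrr eqxx.
rewrite rE => {rE rP}; move: (lead_coef r) => c {r}.
elim: s => [|z s IHs] /=; first by rewrite big_nil alg_polyC.
by move=> /andP[z0 /IHs Qs]; rewrite big_cons scalerAr; apply: QM.
Qed.

(** Every root lies on or below the real axis, hence at least as far from w as
    from z. *)
Lemma upper_stable_cabs2_le r (z w : R[i]) :
    upper_stable r -> Re z = Re w -> `|Im z| <= Im w ->
  cabs2 r.[z] <= cabs2 r.[w].
Proof.
move=> rP zw zwi; move: r rP; apply: upper_stable_ind => [c|r x x0 IHr].
  by rewrite !hornerC.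
rewrite !hornerM !cabs2M ler_pM ?cabs2_ge0 // !hornerE /cabs2 !cE zw lerD2l.
rewrite -[leLHS]real_normK ?num_real // -[leRHS]real_normK ?num_real //.
have := ler_norml (Im z) (Im w); rewrite zwi => /esym /andP[z1 z2].
rewrite lerXn2r ?nnegrE // [leRHS]ger0_norm ?ler_norml; last by lra.
by apply/andP; split; lra.
Qed.

(** The sum of Im (1 / root) acquires the term - Im x / |x| ^ 2. *)
Lemma logslopeM r x : logslope (('X - x%:P) * r) =
  - Im x * cabs2 r.[0] + cabs2 x * logslope r.
Proof.
rewrite /logslope derivM derivXsubC mul1r !hornerE /cabs2 !cE /=; ring.
Qed.

Lemma upper_stable_logslope r : upper_stable r -> 0 <= logslope r.
Proof.
move: r; apply: upper_stable_ind => [c|r x x0 IHr].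
  by rewrite /logslope derivC horner0 !cE /= !(mul0r, mulr0, oppr0) addr0.
by rewrite logslopeM addr_ge0 // mulr_ge0 ?cabs2_ge0 // oppr_ge0.
Qed.

(** The root - i alone contributes Im (1 / - i) = 1 to the sum. *)
Lemma upper_stable_logslope_root r : upper_stable r -> r.[- 'i%C] = 0 ->
  cabs2 r.[0] <= logslope r.
Proof.
move=> rP /eqP; rewrite -[_ == 0]/(root _ _) => /factor_theorem[r1 rE].
have r1P : upper_stable r1.
  by move=> z /rP; rewrite rE hornerM mulf_eq0 negb_or => /andP[].
rewrite rE mulrC logslopeM.
rewrite hornerM cabs2M hornerXsubC.
have := upper_stable_logslope r1P; move: (logslope r1) (cabs2 r1.[0]) => a b a0.
rewrite /cabs2 !cE /=; lra.
Qed.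

End NoRootsAbove.

(** * Substituting one-variable polynomials into multivariate ones *)

Section Substitution.
Variables (R : realType) (n : nat).
Implicit Types (p q : mpoly n R[i]) (z : 'cV[R[i]]_n).

(** The factor F k j takes the place of the j-th power of the k-th variable.
    It need not itself be a j-th power: this leaves room for the homogenised
    powers that arise when a quotient is substituted and denominators are
    cleared. *)
Definition msubst (F : 'I_n -> nat -> {poly R[i]}) q : {poly R[i]} :=
  \sum_(m <- msupp q) (mcoeff m q)%:P * \prod_k F k (m k).

Lemma horner_msubst F q x : (msubst F q).[x] =
  \sum_(m <- msupp q) mcoeff m q * \prod_k (F k (m k)).[x].
Proof.
by rewrite horner_sum; apply: eq_bigr => m _; rewrite hornerM hornerC horner_prod.
Qed.

Lemma deriv_prod (G : 'I_n -> {poly R[i]}) :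
  (\prod_k G k)^`() = \sum_k (G k)^`() * \prod_(i | i != k) G i.
Proof.
have := index_enum_uniq 'I_n; elim: (index_enum _) => [|j s IHs] /=.
  by rewrite !big_nil -[1]/(1%:P) derivC.
case/andP=> js us; rewrite !big_cons eqxx derivM IHs //; congr (_ * _ + _).
  rewrite big_seq [RHS]big_seq_cond; apply: eq_bigl => i.
  by case: (boolP (i \in s)) => //= si; apply/esym; apply: contraNneq js => <-.
rewrite mulr_sumr big_seq [RHS]big_seq; apply: eq_bigr => k ks.
by rewrite big_cons ifT 1?mulrCA //; apply: contraNneq js => ->.
Qed.

Lemma horner_deriv_msubst F q x : (msubst F q)^`().[x] =
  \sum_(m <- msupp q) mcoeff m q *
     \sum_k (F k (m k))^`().[x] * \prod_(i | i != k) (F i (m i)).[x].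
Proof.
rewrite /msubst (big_morph (@deriv _) (@derivD _) (@deriv0 _)) horner_sum.
apply: eq_bigr => m _.
rewrite deriv_mulC hornerM hornerC deriv_prod horner_sum; congr (_ * _).
by apply: eq_bigr => k _; rewrite hornerM horner_prod.
Qed.

Lemma peval_mderiv k q z : peval (mderiv k q) z =
  \sum_(m <- msupp q) mcoeff m q *
     ((m k)%:R * z k 0 ^+ (m k).-1 * \prod_(i | i != k) z i 0 ^+ m i).
Proof.
rewrite /peval /mderiv raddf_sum /=; apply: eq_bigr => m _.
rewrite mevalZ mevalX [(m k)%:R * _]mulrC -!mulrA; congr (_ * (_ * _)).
rewrite (bigD1 k) //=.
rewrite mnmBE mnm1E eqxx subn1; congr (_ * _); apply: eq_bigr => i ik.
by rewrite mnmBE mnm1E eq_sym (negbTE ik) subn0.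
Qed.

Definition mline (f : 'I_n -> {poly R[i]}) q := msubst (fun k j => f k ^+ j) q.

Lemma horner_mline f q x :
  (mline f q).[x] = peval q (\col_k (f k).[x]).
Proof.
rewrite horner_msubst /peval mevalE; apply: eq_bigr => m _; congr (_ * _).
by apply: eq_bigr => k _; rewrite horner_exp mxE.
Qed.

Lemma horner_deriv_mline f q x : (mline f q)^`().[x] =
  \sum_k (f k)^`().[x] * peval (mderiv k q) (\col_i (f i).[x]).
Proof.
rewrite horner_deriv_msubst.
under [RHS]eq_bigr => k _ do rewrite peval_mderiv mulr_sumr.
rewrite exchange_big /=; apply: eq_bigr => m _; rewrite mulr_sumr.
apply: eq_bigr => k _; rewrite [RHS]mulrCA; congr (_ * _).
rewrite deriv_exp hornerMn hornerM horner_exp mxE -mulr_natl.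
rewrite -!mulrA [RHS]mulrCA; congr (_ * (_ * (_ * _))).
by apply: eq_bigr => i ik; rewrite horner_exp mxE.
Qed.

End Substitution.

(** * Stable polynomials on the upper half-space *)

Section UpperHalfSpace.
Variables (R : realType) (n : nat).
Implicit Types (p q : mpoly n R[i]) (z : 'cV[R[i]]_n).

Definition upper z := forall j, 0 < Im (z j 0).

Definition affine (a b : R[i]) : {poly R[i]} := a%:P + b *: 'X.

Lemma horner_affine a b x : (affine a b).[x] = a + b * x.
Proof. by rewrite hornerD hornerC hornerZ hornerX. Qed.

Lemma horner_deriv_affine a b x : (affine a b)^`().[x] = b.
Proof. by rewrite derivD derivC derivZ derivX add0r hornerZ hornerC mulr1. Qed.

(** The points z and w are the values at t = - i and t = i of an affine map
    from C to C^n with a direction in the closed positive orthant.  It sends the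
    upper half-plane into the upper half-space, so that p composed with it has
    no root above the real axis. *)
Lemma stable_cabs2_le p z w : stable p -> upper w ->
    (forall j, Re (z j 0) = Re (w j 0)) ->
    (forall j, `|Im (z j 0)| <= Im (w j 0)) ->
  cabs2 (peval p z) <= cabs2 (peval p w).
Proof.
move=> pP w0 zw zwi.
pose f j := affine ((z j 0 + w j 0) / 2) (- 'i%C * (w j 0 - z j 0) / 2).
have half (x : R[i]) : x / 2 = Complex (Re x / 2) (Im x / 2).
  have h2 : (2 : R[i]) != 0 by rewrite pnatr_eq0.
  apply: (mulIf h2); rewrite mulfVK // mulr_natr mulr2n.
  by apply: complex_ext; rewrite !cE /=; field.
have fz : \col_j (f j).[- 'i%C] = z.
  apply/matrixP => j k; rewrite ord1 mxE horner_affine !half.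
  by have zwj := zw j; apply: complex_ext; rewrite !cE /=; lra.
have fw : \col_j (f j).['i%C] = w.
  apply/matrixP => j k; rewrite ord1 mxE horner_affine !half.
  by have zwj := zw j; apply: complex_ext; rewrite !cE /=; lra.
rewrite -[in leLHS]fz -[in leRHS]fw -!horner_mline.
apply: upper_stable_cabs2_le; rewrite ?cE /= ?oppr0 ?normrN ?normr1 //.
move=> t t0; rewrite horner_mline; apply/eqP; apply: pP => j.
rewrite mxE horner_affine !half !cE /=.
have := zwi j; have := w0 j; rewrite ler_norml zw.
move: (Im (w j 0)) (Im (z j 0)) (Im t) (Re _) t0 => a b c d c0 a0 /andP[ab ba].
have -> : (b + a) / 2 + ((- 0 * (d - d) - -1 * (a - b)) / 2 * c +
   (- 0 * (a - b) + -1 * (d - d)) / 2 * Re t) = ((a + b) + (a - b) * c) / 2.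
  by field.
have [ab0|ab0] := ltP 0 (a + b).
  by rewrite divr_gt0 // ltr_wpDr // mulr_ge0 ?subr_ge0 // ltW.
by rewrite divr_gt0 // ltr_wpDl ?mulr_gt0 //; lra.
Qed.

Lemma stable_neq0 p z : stable p -> upper z -> peval p z != 0.
Proof. by move=> pP zP; apply/eqP; apply: pP. Qed.

(** Up to the factor |p z| ^ 2, this says that N_j = - (d_j p) / p has a
    nonnegative imaginary part.  The restriction of p to the line z + t e_j has
    all its roots below the real axis. *)
Lemma stable_logslope_ge0 p z j : stable p -> upper z ->
  0 <= Im (- peval (mderiv j p) z * conjc (peval p z)).
Proof.
move=> pP zP; pose f k := affine (z k 0) (k == j)%:R.
have f0 : \col_k (f k).[0] = z.
  by apply/matrixP => k l; rewrite ord1 mxE horner_affine mulr0 addr0.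
have : upper_stable (mline f p).
  move=> t t0; rewrite horner_mline stable_neq0 // => k; rewrite mxE horner_affine.
  rewrite !cE; have := zP k; case: (k == j) => /=; nra.
move=> /upper_stable_logslope; rewrite /logslope horner_deriv_mline horner_mline f0.
rewrite (bigD1 j) //= big1 => [|k kj]; last first.
  by rewrite horner_deriv_affine (negbTE kj) mul0r.
by rewrite horner_deriv_affine eqxx mul1r addr0.
Qed.

(** Where p does not vanish, the pencil is zero exactly when eta = N_j z. *)
Definition pencil p j (eta : R[i]) z := peval (mderiv j p) z + eta * peval p z.

(** Otherwise N_j z would be eta, which is in the lower half-plane. *)
Lemma pencil_neq0 p j eta z : stable p -> upper z -> Im eta < 0 ->
  pencil p j eta z != 0.
Proof.
move=> pP zP eta0; apply/negP; rewrite /pencil addr_eq0 => /eqP E.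
have := stable_logslope_ge0 j pP zP; rewrite E opprK.
have := stable_neq0 pP zP; rewrite -cabs2_gt0 /cabs2 !cE.
move: (Re _) (Im (peval _ _)) => a b; nra.
Qed.

(** The pencil has no zero when z moves in the upper half-space while eta moves
    in the lower half-plane, so the reflection argument of [stable_cabs2_le]
    applies to z and eta jointly. *)
Lemma pencil_conj_le p j eta z : stable p -> upper z -> Im eta < 0 ->
  cabs2 (pencil p j (conjc eta) (map_mx conjc z)) <= cabs2 (pencil p j eta z).
Proof.
move=> pP zP eta0.
pose f k := affine (Complex (Re (z k 0)) 0) (Complex (Im (z k 0)) 0).
pose h := affine (Complex (Re eta) 0) (Complex (Im eta) 0).
pose r := mline f (mderiv j p) + h * mline f p.
have rE t : r.[t] = pencil p j h.[t] (\col_k (f k).[t]).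
  by rewrite hornerD hornerM !horner_mline.
have fz : \col_k (f k).['i%C] = z.
  apply/matrixP => k l; rewrite ord1 mxE horner_affine.
  by apply: complex_ext; rewrite !cE /=; ring.
have fzc : \col_k (f k).[- 'i%C] = map_mx conjc z.
  apply/matrixP => k l; rewrite ord1 !mxE horner_affine.
  by apply: complex_ext; rewrite !cE /=; ring.
have hE : h.['i%C] = eta.
  by rewrite horner_affine; apply: complex_ext; rewrite !cE /=; ring.
have hcE : h.[- 'i%C] = conjc eta.
  by rewrite horner_affine; apply: complex_ext; rewrite !cE /=; ring.
rewrite -{1}hcE -{1}hE -fzc -[in leRHS]fz -!rE.
apply: upper_stable_cabs2_le; rewrite ?cE /= ?oppr0 ?normrN ?normr1 //.
move=> t t0; rewrite rE pencil_neq0 //.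
  by move=> k; rewrite mxE horner_affine !cE /=; have := zP k; nra.
by rewrite horner_affine !cE /=; nra.
Qed.

End UpperHalfSpace.

(** * Real Moebius substitutions fixing the origin *)

Section Mobius.
Variables (R : realType) (n : nat) (z : 'cV[R[i]]_n) (D : nat).
Implicit Types (q : mpoly n R[i]) (t : R[i]).
Hypothesis z_upper : upper z.

(** The map t |-> u t / (1 + e t) with e = Re z_k / Im z_k and
    u = |z_k| ^ 2 / Im z_k is the automorphism of the upper half-plane that
    fixes 0 and sends i to z_k; its derivative at 0 is u. *)
Definition mobius_den k : {poly R[i]} :=
  affine 1 (real_complex R (Re (z k 0) / Im (z k 0))).

Definition mobius_slope k : R := cabs2 (z k 0) / Im (z k 0).

Definition mobius t : 'cV[R[i]]_n :=
  \col_k (real_complex R (mobius_slope k) * t / (mobius_den k).[t]).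

(** This is q (mobius t) multiplied by the power [mobius_scale] of the
    denominators, which makes it a polynomial in t as soon as D bounds the
    partial degrees of q. *)
Definition mobius_subst q : {poly R[i]} :=
  msubst (fun k j => (real_complex R (mobius_slope k) *: 'X) ^+ j *
                     mobius_den k ^+ (D - j)) q.

Definition mobius_scale t : R[i] := \prod_k (mobius_den k).[t] ^+ D.

Definition degree_le q := forall m k, m \in msupp q -> (m k <= D)%N.

Lemma horner_mobius_subst q t : degree_le q ->
    (forall k, (mobius_den k).[t] != 0) ->
  (mobius_subst q).[t] = mobius_scale t * peval q (mobius t).
Proof.
move=> qD t0; rewrite horner_msubst /peval mevalE mulr_sumr big_seq [RHS]big_seq.
apply: eq_bigr => m mq; rewrite mulrCA -big_split; congr (_ * _).
apply: eq_bigr => k _ /=; rewrite hornerM !horner_exp hornerZ hornerX mxE.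
rewrite expr_div_n -[in RHS](subnK (qD _ k mq)) exprD.
have := expf_neq0 (m k) (t0 k); move: (_ ^+ m k) (_ ^+ m k) (_ ^+ (D - m k)).
by move=> c a b c0; field.
Qed.

Lemma mobius_den0 k : (mobius_den k).[0] = 1.
Proof. by rewrite horner_affine mulr0 addr0. Qed.

Lemma mobius0 : mobius 0 = 0.
Proof. by apply/matrixP => k j; rewrite !mxE mulr0 mul0r. Qed.

Lemma mobius_subst0 q : degree_le q -> (mobius_subst q).[0] = peval q 0.
Proof.
move=> qD; rewrite horner_mobius_subst //; last first.
  by move=> k; rewrite mobius_den0 oner_neq0.
rewrite mobius0 /mobius_scale big1 ?mul1r // => k _.
by rewrite mobius_den0 expr1n.
Qed.

(** The first term comes from the denominators.  Its factor is real and is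
    the same for all q; this is why it cancels in [logslope_real_pencil]. *)
Lemma deriv_mobius_subst0 q : degree_le q -> (mobius_subst q)^`().[0] =
  real_complex R (\sum_k (Re (z k 0) / Im (z k 0)) *+ D) * peval q 0 +
  \sum_k real_complex R (mobius_slope k) * peval (mderiv k q) 0.
Proof.
move=> qD; rewrite horner_deriv_msubst.
under [X in _ + X]eq_bigr => k _ do rewrite peval_mderiv mulr_sumr.
rewrite /peval mevalE mulr_sumr [X in _ + X]exchange_big -big_split /= big_seq [RHS]big_seq.
apply: eq_bigr => m mq; rewrite mulrCA.
under [X in _ + X]eq_bigr => k _ do rewrite mulrCA.
rewrite -mulr_sumr -mulrDr; congr (_ * _).
rewrite rmorph_sum mulr_suml -big_split /=; apply: eq_bigr => k _.
rewrite [X in _ * X + _](bigD1 k) //= !mxE mulrA mulrA -mulrDl; congr (_ * _).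
  have den0' : (mobius_den k)^`().[0] = real_complex R (Re (z k 0) / Im (z k 0)).
    by rewrite horner_deriv_affine.
  rewrite derivM hornerD !hornerM !deriv_exp !hornerMn !hornerM !horner_exp.
  rewrite den0' mobius_den0 !expr1n !mulr1 derivZ derivX !hornerZ hornerX hornerC.
  rewrite mulr0 mulr1.
  rewrite addrC rmorphMn /=; congr (_ + _); last by rewrite -mulr_natl mulrCA.
  case: (m k) (qD m k mq) => [_|i _]; first by rewrite expr0 mul1r mulr1 subn0.
  by rewrite !expr0n /= mulr0 mul0r.
apply: eq_bigr => i ik; rewrite !mxE hornerM !horner_exp hornerZ hornerX mulr0.
by rewrite mobius_den0 expr1n mulr1.
Qed.

Lemma mobius_den_neq0 k t : Im t != 0 -> (mobius_den k).[t] != 0.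
Proof.
rewrite horner_affine eq_complex !cE /=; move: (Re (z k 0) / _) => e t0.
apply/negP => /andP[/eqP re0 /eqP im0].
have : e * Im t = 0 by lra.
move=> /eqP; rewrite mulf_eq0 (negbTE t0) orbF => /eqP e0.
by move: re0; rewrite e0; lra.
Qed.

Lemma mobius_i : mobius 'i%C = z.
Proof.
have i0 : Im ('i%C : R[i]) != 0 by rewrite oner_eq0.
apply/matrixP => k j; rewrite ord1 mxE; apply: (canLR (mulfK (mobius_den_neq0 k i0))).
have zk := z_upper k; rewrite horner_affine.
by apply: complex_ext; rewrite !cE /= /mobius_slope /cabs2; field; rewrite gt_eqF.
Qed.

Lemma mobius_slope_gt0 k : 0 < mobius_slope k.
Proof.
rewrite divr_gt0 ?z_upper // cabs2_gt0; apply/eqP => z0.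
by have := z_upper k; rewrite z0 ltxx.
Qed.

Lemma upper_mobius t : 0 < Im t -> upper (mobius t).
Proof.
move=> t0 k; have d0 := mobius_den_neq0 k (lt0r_neq0 t0).
set v := mobius t k 0.
have : Im (v * (mobius_den k).[t] * conjc (mobius_den k).[t]) =
       mobius_slope k * Im t.
  rewrite /v mxE divfK // horner_affine !cE /=; ring.
have -> : Im (v * (mobius_den k).[t] * conjc (mobius_den k).[t]) =
          Im v * cabs2 (mobius_den k).[t] by rewrite /cabs2 !cE; ring.
move=> E; have : 0 < Im v * cabs2 (mobius_den k).[t].
  by rewrite E mulr_gt0 ?mobius_slope_gt0.
by rewrite pmulr_lgt0 // cabs2_gt0.
Qed.

Lemma mobius_den_conj k t : (mobius_den k).[conjc t] = conjc (mobius_den k).[t].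
Proof. by rewrite !horner_affine; apply: complex_ext; rewrite !cE /=; ring. Qed.

Lemma mobius_scale_conj t : mobius_scale (conjc t) = conjc (mobius_scale t).
Proof.
rewrite /mobius_scale rmorph_prod; apply: eq_bigr => k _.
by rewrite rmorphXn /= mobius_den_conj.
Qed.

Lemma mobius_conj t : mobius (conjc t) = map_mx conjc (mobius t).
Proof.
apply/matrixP => k j; rewrite !mxE mobius_den_conj [RHS]rmorphM [X in _ = X * _]rmorphM /=.
by rewrite oppr0 conjc_inv.
Qed.

Lemma mobius_scale_neq0 t : Im t != 0 -> mobius_scale t != 0.
Proof.
by move=> t0; apply/prodf_neq0 => k _; rewrite expf_neq0 ?mobius_den_neq0.
Qed.

End Mobius.

(** * Julia's lemma for the logarithmic derivatives of a stable polynomial *)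

Section Julia.
Variables (R : realType) (n : nat) (p : mpoly n R[i]) (j : 'I_n).
Implicit Types (z : 'cV[R[i]]_n) (t w eta : R[i]).

(** For a real polynomial p with p 0 = 1 and for u = mobius_slope z this is the
    derivative at t = 0 of N_j (mobius z t), that is, the number f'(0) in
    Julia's lemma.  The last term is the contribution of the extra variable
    xi. *)
Definition julia_bound (u : 'I_n -> R) : R :=
  (\sum_k u k * (Re (peval (mderiv j p) 0) * Re (peval (mderiv k p) 0) -
                 Re (peval (mderiv k (mderiv j p)) 0)))
  - Im (peval (mderiv j p) 0).

Hypotheses (p_stable : stable p) (p0 : peval p 0 = 1).
Variable z : 'cV[R[i]]_n.
Hypothesis z_upper : upper z.

Let D := (msize p + msize (mderiv j p))%N.

(** With p* for p with conjugated coefficients, the polynomial a + xi b equals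
    (p (1 - i xi) + p* (1 + i xi)) / 2.  Here xi = t, and this is the half that
    involves p; [real_pencil] adds the other half. *)
Definition half_pencil eta : {poly R[i]} := affine 1 (- 'i%C) *
  (mobius_subst z D (mderiv j p) + eta *: mobius_subst z D p).

Definition real_pencil eta : {poly R[i]} :=
  half_pencil eta + map_poly conjc (half_pencil (conjc eta)).

Lemma degree_le_msize (q : mpoly n R[i]) N : (msize q <= N)%N -> degree_le N q.
Proof.
move=> qN m k mq; apply: leq_trans qN; apply: ltnW.
apply: leq_ltn_trans (msize_mdeg_lt mq).
by rewrite mdegE (bigD1 k) //= leq_addr.
Qed.

Let degp : degree_le D p. Proof. by apply/degree_le_msize/leq_addr. Qed.
Let degpj : degree_le D (mderiv j p).
Proof. by apply/degree_le_msize/leq_addl. Qed.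

Lemma horner_half_pencil eta t : Im t != 0 -> (half_pencil eta).[t] =
  (1 - 'i%C * t) * (mobius_scale z D t * pencil p j eta (mobius z t)).
Proof.
move=> t0; have den0 k := mobius_den_neq0 z k t0.
rewrite hornerM horner_affine hornerD hornerZ !horner_mobius_subst //.
by rewrite /pencil; ring.
Qed.

Lemma horner_real_pencil eta t :
  (real_pencil eta).[t] =
  (half_pencil eta).[t] + conjc (half_pencil (conjc eta)).[conjc t].
Proof. by rewrite hornerD -[in X in _ + X](conjcK t) horner_map. Qed.

(** Above the real axis the first half strictly dominates: its factor 1 - i t
    has the larger modulus, and the two pencils compare by
    [pencil_conj_le]. *)
Lemma upper_stable_real_pencil eta : Im eta < 0 -> upper_stable (real_pencil eta).
Proof.
move=> eta0 t t0; rewrite horner_real_pencil.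
have tn0 : Im t != 0 by rewrite gt_eqF.
have tcn0 : Im (conjc t) != 0 by rewrite Im_conjc oppr_eq0.
have mt := upper_mobius z_upper t0.
suff : cabs2 (conjc (half_pencil (conjc eta)).[conjc t]) <
       cabs2 (half_pencil eta).[t].
  apply: contraTneq => /eqP; rewrite addr_eq0 => /eqP ->.
  by rewrite /cabs2 !Re_opp !Im_opp !sqrrN ltxx.
rewrite cabs2_conj !horner_half_pencil // mobius_scale_conj mobius_conj.
rewrite !cabs2M cabs2_conj.
have le := pencil_conj_le j p_stable mt eta0.
have gt0 := pencil_neq0 j p_stable mt eta0; rewrite -cabs2_gt0 in gt0.
have s0 := mobius_scale_neq0 z D tn0; rewrite -cabs2_gt0 in s0.
apply: le_lt_trans (_ : cabs2 (1 - 'i%C * conjc t) * (cabs2 (mobius_scale z D t) *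
  cabs2 (pencil p j eta (mobius z t))) < _).
  by rewrite ler_wpM2l ?cabs2_ge0 // ler_wpM2l ?cabs2_ge0.
rewrite ltr_pM2r ?mulr_gt0 // /cabs2 !cE /=; nra.
Qed.

Let Pj := peval (mderiv j p) 0.
Let slope := mobius_slope z.

Lemma real_pencil0 eta : (real_pencil eta).[0] = (real_complex R (Re Pj) + eta) *+ 2.
Proof.
rewrite horner_real_pencil conjc0 /half_pencil !hornerM !horner_affine !mulr0.
rewrite !addr0 !mul1r !hornerD !hornerZ !mobius_subst0 // p0 !mulr1 -/Pj mulr2n.
by apply: complex_ext; rewrite !cE /=; ring.
Qed.

Lemma half_pencil_deriv0 eta : (half_pencil eta)^`().[0] =
  - 'i%C * (Pj + eta) +
  ((mobius_subst z D (mderiv j p))^`().[0] + eta * (mobius_subst z D p)^`().[0]).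
Proof.
rewrite derivM hornerD !hornerM horner_deriv_affine horner_affine mulr0 addr0.
by rewrite mul1r derivD derivZ !hornerD !hornerZ !mobius_subst0 // p0 mulr1.
Qed.

(** For r = real_pencil eta, the quotient - r'(0) / r(0) is a real constant plus
    [julia_bound] / (eta - Re (N_j 0)). *)
Lemma logslope_real_pencil eta :
  logslope (real_pencil eta) = - (4 * Im eta * julia_bound slope).
Proof.
rewrite /logslope real_pencil0 /real_pencil derivD hornerD deriv_map.
rewrite -[X in (map_poly _ _).[X]]conjc0 horner_map !half_pencil_deriv0.
rewrite !deriv_mobius_subst0 // p0 -/Pj.
rewrite /julia_bound -/Pj.
under [in RHS]eq_bigr => k _ do rewrite mulrBr mulrCA.
rewrite sumrB -mulr_sumr.
have ReS (G : 'I_n -> R[i]) :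
    Re (\sum_k real_complex R (mobius_slope z k) * G k) =
    \sum_k slope k * Re (G k).
  by rewrite Re_sum; apply: eq_bigr => k _; rewrite !cE /= mul0r subr0.
rewrite -!ReS; move: (\sum_k _ * _) (\sum_k _ * _) (\sum_k _) => V Vj kap.
rewrite !mulr2n !cE /=; ring.
Qed.

Lemma cabs2_real_pencil0 eta :
  cabs2 (real_pencil eta).[0] = 4 * ((Re Pj + Re eta) ^+ 2 + Im eta ^+ 2).
Proof. by rewrite real_pencil0 mulr2n /cabs2 !cE /=; ring. Qed.

Lemma julia_bound_ge0 : 0 <= julia_bound slope.
Proof.
have := @upper_stable_real_pencil (- 'i%C).
rewrite Im_opp /= oppr_lt0 ltr01 => /(_ isT) /upper_stable_logslope.
by rewrite logslope_real_pencil Im_opp /=; lra.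
Qed.

Lemma real_pencil_i eta : (real_pencil eta).['i%C] =
  2 * (mobius_scale z D 'i%C * pencil p j eta z).
Proof.
have i0 : Im ('i%C : R[i]) != 0 by rewrite oner_eq0.
have ic0 : Im (conjc 'i%C : R[i]) != 0 by rewrite Im_conjc oppr_eq0 oner_eq0.
rewrite horner_real_pencil !horner_half_pencil // mobius_i //.
have -> : 1 - 'i%C * conjc 'i%C = 0 :> R[i].
  by apply: complex_ext; rewrite !cE /=; ring.
rewrite mul0r conjc0 addr0; congr (_ * _).
by apply: complex_ext; rewrite !cE /=; ring.
Qed.

(** At t = - i the factor 1 - i t of the first half vanishes, and the second
    half is the conjugate of the pencil at z.  Hence - i is a root when the
    conjugate of eta is N_j z. *)
Lemma real_pencil_ni eta : (real_pencil eta).[- 'i%C] =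
  2 * conjc (mobius_scale z D 'i%C * pencil p j (conjc eta) z).
Proof.
have i0 : Im ('i%C : R[i]) != 0 by rewrite oner_eq0.
have ni0 : Im (- 'i%C : R[i]) != 0 by rewrite Im_opp oppr_eq0 oner_eq0.
have nic : conjc (- 'i%C) = 'i%C :> R[i].
  by apply: complex_ext; rewrite !cE /=; ring.
rewrite horner_real_pencil nic !horner_half_pencil // mobius_i //.
have -> : 1 - 'i%C * - 'i%C = 0 :> R[i].
  by apply: complex_ext; rewrite !cE /=; ring.
rewrite mul0r add0r rmorphM; congr (_ * _).
by apply: complex_ext; rewrite !cE /=; ring.
Qed.

Lemma pencil_root_Im_ge0 w : pencil p j w z = 0 -> 0 <= Im w.
Proof.
rewrite leNgt => w0; apply/negP => wlt.
by have := pencil_neq0 j p_stable z_upper wlt; rewrite w0 eqxx.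
Qed.

(** Here w = N_j z.  When Im w > 0, the real pencil at the conjugate of w has
    the root - i, and the inequality reads 1 <= Im (- r'(0) / r(0)).  When w is
    real the pencil may lose its stability; then w equals Re (N_j 0), as
    the real pencils at w - i d, which are stable, show when d tends to 0. *)
Lemma julia w : pencil p j w z = 0 ->
  (Re w + Re Pj) ^+ 2 + Im w ^+ 2 <= Im w * julia_bound slope.
Proof.
move=> w0; have := pencil_root_Im_ge0 w0; rewrite le_eqVlt => /predU1P[/esym wi|wi].
  rewrite wi mul0r expr0n addr0.
  set C := cabs2 (mobius_scale z D 'i%C) * cabs2 (peval p z).
  have C0 : 0 <= C by rewrite mulr_ge0 ?cabs2_ge0.
  (* The real pencil at i is of size d, and its modulus at 0 is no larger. *)
  have small d : 0 < d -> (Re w + Re Pj) ^+ 2 <= d ^+ 2 * C.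
    move=> d0; pose eta : R[i] := w - 'i%C * real_complex R d.
    have eta0 : Im eta < 0 by rewrite !cE /= wi; lra.
    have := @upper_stable_cabs2_le _ _ 0 'i%C (upper_stable_real_pencil eta0) erefl.
    rewrite normr0 ler01 => /(_ isT).
    rewrite cabs2_real_pencil0 real_pencil_i.
    have -> : pencil p j eta z = - 'i%C * real_complex R d * peval p z.
      by rewrite /pencil mulrDl addrA -/(pencil p j w z) w0 add0r !mulNr.
    rewrite !cabs2M.
    have -> : Re eta = Re w by rewrite !cE /=; ring.
    have -> : cabs2 (- 'i%C : R[i]) = 1 by rewrite /cabs2 !cE /=; ring.
    have -> : cabs2 (real_complex R d) = d ^+ 2.
      by rewrite /cabs2 /=; ring.
    have -> : cabs2 (2 : R[i]) = 4 by rewrite /cabs2 !cE /=; ring.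
    by rewrite ler_pM2l // /C; have := sqr_ge0 (Im eta); lra.
  have [->|a0] := eqVneq (Re w + Re Pj) 0; first by rewrite expr0n.
  have := small (`|Re w + Re Pj| / (C + 1)).
  rewrite divr_gt0 ?normr_gt0 // ?ltr_wpDl // => /(_ isT).
  rewrite expr_div_n real_normK ?num_real // -mulrA -[leLHS]mulr1.
  rewrite ler_pM2l ?exprn_even_gt0 // mulrC ler_pdivlMr ?exprn_gt0 ?ltr_wpDl //.
  by nra.
have eta0 : Im (conjc w) < 0 by rewrite Im_conjc oppr_lt0.
have := upper_stable_logslope_root (upper_stable_real_pencil eta0).
rewrite real_pencil_ni conjcK w0 mulr0 conjc0 mulr0 => /(_ erefl).
rewrite logslope_real_pencil cabs2_real_pencil0 Re_conjc Im_conjc sqrrN.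
by rewrite [Re Pj + _]addrC; lra.
Qed.

End Julia.

(** * Integrating the growth along a ray *)

Section Gronwall.
Variable R : realType.

(** The hypothesis says that the derivative of P exp Q is nonpositive. *)
Lemma poly_gronwall (P Q : {poly R}) :
    (forall t, 0 < t < 1 -> (P^`() + Q^`() * P).[t] <= 0) ->
  P.[1] * expR Q.[1] <= P.[0] * expR Q.[0].
Proof.
move=> PQ; pose f := horner P * (expR \o horner Q).
have fd (t : R) : is_derive t 1 f (expR Q.[t] * (P^`() + Q^`() * P).[t]).
  apply: is_derive_eq; rewrite /= !hornerE /GRing.scale /=; ring.
have := @ler0_derive1_le_cc _ f 0 1 _ _ _ 1 0; apply.
- by move=> t _; have := fd t.
- move=> t; rewrite in_itv /= => /PQ t0; rewrite derive1E derive_val.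
  by rewrite mulr_ge0_le0 ?expR_ge0.
- apply: continuous_subspaceT => t.
  by apply: differentiable_continuous; apply/derivable1_diffP; have := fd t.
- by rewrite in_itv /= lexx ler01.
- by rewrite in_itv /= lexx ler01.
- exact: ler01.
Qed.

Definition Re_poly (g : {poly R[i]}) : {poly R} := \poly_(i < size g) Re g`_i.
Definition Im_poly (g : {poly R[i]}) : {poly R} := \poly_(i < size g) Im g`_i.

Lemma coef_Re_poly g i : (Re_poly g)`_i = Re g`_i.
Proof. by rewrite coef_poly; case: ltnP => // /(nth_default 0) ->. Qed.

Lemma coef_Im_poly g i : (Im_poly g)`_i = Im g`_i.
Proof. by rewrite coef_poly; case: ltnP => // /(nth_default 0) ->. Qed.

Lemma deriv_Re_poly g : (Re_poly g)^`() = Re_poly g^`().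
Proof.
apply/polyP => i; rewrite coef_deriv !coef_Re_poly coef_deriv.
by rewrite -[in RHS]mulr_natl !cE /= -[in RHS](rmorph_nat (real_complex R)) /=
           mul0r subr0 mulr_natl.
Qed.

Lemma deriv_Im_poly g : (Im_poly g)^`() = Im_poly g^`().
Proof.
apply/polyP => i; rewrite coef_deriv !coef_Im_poly coef_deriv.
by rewrite -[in RHS]mulr_natl !cE /= -[in RHS](rmorph_nat (real_complex R)) /=
           mul0r addr0 mulr_natl.
Qed.

Lemma horner_Re_poly g t : (Re_poly g).[t] = Re g.[real_complex R t].
Proof.
rewrite horner_poly horner_coef Re_sum; apply: eq_bigr => i _.
by rewrite -rmorphXn !cE /= mulr0 subr0.
Qed.

Lemma horner_Im_poly g t : (Im_poly g).[t] = Im g.[real_complex R t].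
Proof.
rewrite horner_poly horner_coef Im_sum; apply: eq_bigr => i _.
by rewrite -rmorphXn !cE /= mulr0 add0r.
Qed.

(** Twice the left-hand side of the hypothesis is the derivative of |g| ^ 2. *)
Lemma cabs2_gronwall (g : {poly R[i]}) (a b : R) :
    (forall t, 0 < t < 1 ->
       Re (g^`().[real_complex R t] * conjc g.[real_complex R t]) <=
         cabs2 g.[real_complex R t] * (a + b * t)) ->
  cabs2 g.[1] <= cabs2 g.[0] * expR (2 * a + b).
Proof.
move=> gP; pose P := Re_poly g ^+ 2 + Im_poly g ^+ 2.
pose Q := - ((2 * a) *: 'X + b *: 'X^2).
have PE t : P.[t] = cabs2 g.[real_complex R t].
  by rewrite !hornerE horner_Re_poly horner_Im_poly.
have QE t : Q.[t] = - (2 * a * t + b * t ^+ 2).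
  by rewrite !hornerE.
have := @poly_gronwall P Q _; rewrite !PE !QE.
rewrite !mulr0 expr0n /= mulr0 addr0 oppr0 expR0 mulr1 expr1n !mulr1 expRN.
rewrite ler_pdivrMr ?expR_gt0 //; apply => t /gP t01.
rewrite hornerD hornerM PE /P /Q derivN !derivD !derivZ derivX derivXn /=.
rewrite !deriv_exp deriv_Re_poly deriv_Im_poly !hornerE.
rewrite !horner_Re_poly !horner_Im_poly; move: t01; rewrite /cabs2 !cE.
set A := Re g.[_]; set B := Im g.[_]; move: (Re _) (Im _) => C E.
rewrite /= => h; lra.
Qed.

End Gronwall.

(** * The bound at a point of the upper half-space *)

Section BoundAtUpperPoint.
Variables (R : realType) (n : nat) (p : mpoly n R[i]).
Hypotheses (p_stable : stable p) (p0 : peval p 0 = 1).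
Variable z : 'cV[R[i]]_n.
Hypothesis z_upper : upper z.

(** The hypothesis says that a + i b lies in the disc of centre i k / 2 and
    radius k / 2, and the left-hand side is - Re ((x + i y) (a + i b)). *)
Lemma disc_re_bound (x y a b k : R) : 0 <= k -> a ^+ 2 + b ^+ 2 <= b * k ->
  y * b - x * a <= k / 2 * (y + Num.sqrt (x ^+ 2 + y ^+ 2)).
Proof.
move=> k0 ab; set r := Num.sqrt _.
have r0 : 0 <= r by apply: sqrtr_ge0.
have r2 : r ^+ 2 = x ^+ 2 + y ^+ 2 by rewrite sqr_sqrtr ?addr_ge0 ?sqr_ge0.
suff : y * (b - k / 2) - x * a <= k / 2 * r by lra.
have k20 : 0 <= k / 2 by lra.
apply: le_trans (ler_norm _) _; rewrite -ler_sqr ?nnegrE ?(mulr_ge0 k20) //.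
rewrite real_normK ?num_real // exprMn r2.
apply: le_trans (_ : (x ^+ 2 + y ^+ 2) * (a ^+ 2 + (b - k / 2) ^+ 2) <= _).
  by have := sqr_ge0 (y * a + x * (b - k / 2)); lra.
by rewrite mulrC ler_wpM2r ?addr_ge0 ?sqr_ge0 //; lra.
Qed.

Let Pj j := peval (mderiv j p) 0.
Let absz j := Num.sqrt (cabs2 (z j 0)).

(** For a polynomial with real coefficients and value 1 at 0 this is the
    Hessian of - log p at 0. *)
Definition re_log_hessian j k : R :=
  Re (Pj j) * Re (Pj k) - Re (peval (mderiv k (mderiv j p)) 0).

(** Gronwall's argument along the ray t z.  At t z the slopes of the Moebius
    maps are t times those at z, so that by [julia] the rate of growth is
    bounded by an affine function of t. *)
Lemma stable_cabs2_bound : cabs2 (peval p z) <=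
  expR (2 * (\sum_j (Re (Pj j) * Re (z j 0)
                     - Im (Pj j) * (Im (z j 0) + absz j) / 2))
        + \sum_j (\sum_k mobius_slope z k * re_log_hessian j k)
                 * (Im (z j 0) + absz j) / 2).
Proof.
pose f j := affine 0 (z j 0).
have fE t : \col_j (f j).[t] = t *: z.
  by apply/matrixP => j k; rewrite ord1 !mxE horner_affine add0r mulrC.
have := @cabs2_gronwall _ (mline f p).
move=> gronwall; rewrite -[z in leLHS]scale1r -(fE 1) -horner_mline.
apply: le_trans (gronwall _ _ _) _; last first.
  rewrite horner_mline fE scale0r p0.
  have -> : cabs2 (1 : R[i]) = 1 by rewrite /cabs2 /= expr0n expr1n addr0.
  by rewrite mul1r.
move=> t /andP[t0 t1].
rewrite horner_deriv_mline horner_mline !fE.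
rewrite [in leLHS]mulr_suml Re_sum.
set w := real_complex R t *: z.
have wE j : w j 0 = real_complex R t * z j 0 by rewrite mxE.
have w_upper : upper w by move=> j; rewrite wE !cE /= mul0r addr0 mulr_gt0.
rewrite [in leRHS]mulr_suml -big_split mulr_sumr /=.
apply: ler_sum => j _; rewrite horner_deriv_affine.
have pw0 := stable_neq0 p_stable w_upper.
pose v := - (peval (mderiv j p) w / peval p w).
have v0 : pencil p j v w = 0 by rewrite /pencil mulNr divfK // subrr.
have -> : peval (mderiv j p) w = - v * peval p w by rewrite opprK divfK.
have := julia p_stable p0 w_upper v0.
have := julia_bound_ge0 j p_stable p0 w_upper.
have -> : julia_bound p j (mobius_slope w) =
    t * (\sum_k mobius_slope z k * re_log_hessian j k) - Im (Pj j).
  rewrite /julia_bound mulr_sumr; congr (_ - _); apply: eq_bigr => k _.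
  rewrite mulrA; congr (_ * _); rewrite /mobius_slope wE /cabs2 !cE /=.
  by field; rewrite (gt_eqF t0) gt_eqF ?z_upper.
move=> k0 /(disc_re_bound (Re (z j 0)) (Im (z j 0)) k0).
rewrite -/(cabs2 _) -/(absz j).
have -> : Re (z j 0 * (- v * peval p w) * conjc (peval p w)) =
   cabs2 (peval p w) * (Im (z j 0) * Im v - Re (z j 0) * Re v).
  by rewrite /cabs2 !cE; ring.
have := cabs2_ge0 (peval p w).
move=> c0 le; rewrite ler_wpM2l //; rewrite -/(Pj j) in le; lra.
Qed.

End BoundAtUpperPoint.

(** * Euclidean and operator norms *)

Section EuclideanNorms.
Variable R : realType.

Definition rnorm n (a : 'I_n -> R) : R := Num.sqrt (\sum_j a j ^+ 2).

Lemma rnorm_ge0 n (a : 'I_n -> R) : 0 <= rnorm a.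
Proof. exact: sqrtr_ge0. Qed.

Lemma rnorm_sqr n (a : 'I_n -> R) : rnorm a ^+ 2 = \sum_j a j ^+ 2.
Proof. by rewrite sqr_sqrtr // sumr_ge0 // => j _; apply: sqr_ge0. Qed.

Lemma cauchy_schwarz n (a b : 'I_n -> R) :
  `|\sum_j a j * b j| <= rnorm a * rnorm b.
Proof.
rewrite -ler_sqr ?nnegrE ?mulr_ge0 ?rnorm_ge0 // real_normK ?num_real //.
rewrite exprMn !rnorm_sqr -subr_ge0 -(pmulr_rge0 _ (ltr0n _ 2)).
suff -> : 2 * ((\sum_j a j ^+ 2) * (\sum_j b j ^+ 2) - (\sum_j a j * b j) ^+ 2) =
          \sum_j \sum_k (a j * b k - a k * b j) ^+ 2.
  by do 2!(apply: sumr_ge0 => ? _); apply: sqr_ge0.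
have expand j k : (a j * b k - a k * b j) ^+ 2 =
    a j ^+ 2 * b k ^+ 2 + b j ^+ 2 * a k ^+ 2 - 2 * (a j * b j) * (a k * b k).
  by ring.
under [RHS]eq_bigr => j _.
  under eq_bigr => k _ do rewrite expand.
  rewrite sumrB big_split /= -!mulr_sumr; over.
by rewrite sumrB big_split /= -!mulr_suml -mulr_sumr; ring.
Qed.

Lemma l2normE n (v : 'cV[R[i]]_n) :
  l2norm v = rnorm (fun j => Normc.normc (v j 0)).
Proof. by []. Qed.

Lemma l2norm_ge0 n (v : 'cV[R[i]]_n) : 0 <= l2norm v.
Proof. exact: rnorm_ge0. Qed.

Lemma l2norm_sqr n (v : 'cV[R[i]]_n) : l2norm v ^+ 2 = \sum_j cabs2 (v j 0).
Proof.
by rewrite l2normE rnorm_sqr; apply: eq_bigr => j _; rewrite normc_sqr.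
Qed.

Lemma normc_ge0 (x : R[i]) : 0 <= Normc.normc x.
Proof. by rewrite normc_cabs2 sqrtr_ge0. Qed.

Lemma rnorm_le n (a b : 'I_n -> R) :
  (forall j, 0 <= a j <= b j) -> rnorm a <= rnorm b.
Proof.
move=> ab; rewrite ler_wsqrtr // ler_sum // => j _.
by have /andP[? ?] := ab j; rewrite lerXn2r ?nnegrE // (le_trans (y := a j)).
Qed.

Lemma ler_rnorm n (a : 'I_n -> R) j : `|a j| <= rnorm a.
Proof.
rewrite -sqrtr_sqr ler_wsqrtr // (bigD1 j) //= lerDl sumr_ge0 // => k _.
exact: sqr_ge0.
Qed.

Lemma l2normZ n (c : R) (v : 'cV[R[i]]_n) : 0 <= c ->
  l2norm (real_complex R c *: v) = c * l2norm v.
Proof.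
move=> c0; rewrite -[c in RHS]ger0_norm // -sqrtr_sqr -sqrtrM ?sqr_ge0 //.
rewrite mulr_sumr; congr Num.sqrt; apply: eq_bigr => j _.
by rewrite mxE !normc_sqr cabs2M /cabs2 /= expr0n addr0.
Qed.

Lemma opnorm_has_sup m n (A : 'M[R[i]]_(m, n)) :
  has_sup [set l2norm (A *m v) | v in [set v : 'cV[R[i]]_n | l2norm v <= 1]]%classic.
Proof.
split.
  exists (l2norm (A *m 0)), 0 => //=.
  by rewrite /l2norm big1 ?sqrtr0 // => j _; rewrite normc_sqr mxE /cabs2 /= expr0n addr0.
exists (rnorm (fun j => \sum_k Normc.normc (A j k))) => _ [v /= v1 <-].
rewrite l2normE; apply: rnorm_le => j; rewrite normc_ge0 mxE /=.
apply: (@le_trans _ _ (\sum_k Normc.normc (A j k * v k 0))).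
  elim/big_ind2: _ => [|x a y b xa yb|k _]; rewrite ?Normc.normc0 //.
  by apply: le_trans (le_normcD _ _) _; rewrite lerD.
apply: ler_sum => k _; rewrite Normc.normcM ler_piMr ?normc_ge0 //.
have := ler_rnorm (fun j => Normc.normc (v j 0)) k.
by rewrite ger0_norm ?normc_ge0 // => /le_trans; apply.
Qed.

Lemma opnorm_ge0 m n (A : 'M[R[i]]_(m, n)) : 0 <= opnorm A.
Proof.
apply: le_trans (l2norm_ge0 (A *m 0)) _.
apply: (ub_le_sup (opnorm_has_sup A).2); exists 0 => //=.
by rewrite /l2norm big1 ?sqrtr0 // => j _; rewrite normc_sqr mxE /cabs2 /= expr0n addr0.
Qed.

Lemma l2norm_mulmx_le m n (A : 'M[R[i]]_(m, n)) (v : 'cV[R[i]]_n) :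
  l2norm (A *m v) <= opnorm A * l2norm v.
Proof.
have [v0|v0] := eqVneq (l2norm v) 0.
  have -> : v = 0.
    apply/matrixP => j k; rewrite ord1 mxE; apply/eqP; rewrite -cabs2_eq0.
    have /eqP := l2norm_sqr v; rewrite v0 expr0n eq_sym psumr_eq0 => [|i _].
      by move=> /allP /(_ j); rewrite mem_index_enum => /(_ isT).
    exact: cabs2_ge0.
  rewrite mulmx0 /l2norm !big1 ?sqrtr0 ?mulr0 // => j _;
    by rewrite normc_sqr mxE /cabs2 /= expr0n addr0.
have vgt0 : 0 < l2norm v by rewrite lt_def v0 l2norm_ge0.
rewrite -ler_pdivrMr // mulrC -l2normZ ?invr_ge0 ?l2norm_ge0 // scalemxAr.
apply: (ub_le_sup (opnorm_has_sup A).2); exists (real_complex R (l2norm v)^-1 *: v) => //=.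
by rewrite l2normZ ?invr_ge0 ?l2norm_ge0 // mulVf.
Qed.

End EuclideanNorms.

(** * From the upper half-space to all points *)

Section EuclideanBound.
Variable R : realType.

(** Here y = max (b, |x| / sqrt 3), which makes the argument of |x| + i y
    at least 30 degrees.  Among the arguments that real points can be raised to,
    this one is optimal: u = |x + i y| ^ 2 / y and v = y + |x + i y|
    satisfy u v = 4 x ^ 2 there.  The weights 3 / 4 and 4 / 3, of product 1, give
    u v after summation over the coordinates; at a real point they make both
    terms equal. *)
Lemma elevation_exists (x b : R) : 0 < b -> exists2 y, b <= y &
  let r := Num.sqrt (x ^+ 2 + y ^+ 2) in
  3 / 4 * ((x ^+ 2 + y ^+ 2) / y) ^+ 2 + 4 / 3 * (y + r) ^+ 2
    <= 8 * (x ^+ 2 + b ^+ 2) /\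
  x ^+ 2 + ((y + r) / 2) ^+ 2 <= 2 * (x ^+ 2 + b ^+ 2).
Proof.
move=> b0; have [xb|xb] := leP (x ^+ 2) (3 * b ^+ 2).
  exists b => //; set r := Num.sqrt _; have r0 : 0 <= r by apply: sqrtr_ge0.
  have r2 : x ^+ 2 + b ^+ 2 = r ^+ 2 by rewrite sqr_sqrtr ?addr_ge0 ?sqr_ge0.
  have br : b <= r.
    by rewrite -ler_sqr ?nnegrE ?(ltW b0) // -r2 lerDr sqr_ge0.
  have rb : r <= 2 * b.
    by rewrite -ler_sqr ?nnegrE ?mulr_ge0 ?(ltW b0) // -r2; lra.
  rewrite r2 /=; split; last first.
    have -> : x ^+ 2 = r ^+ 2 - b ^+ 2 by lra.
    by nra.
  have -> : 3 / 4 * (r ^+ 2 / b) ^+ 2 + 4 / 3 * (b + r) ^+ 2 =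
     (3 / 4 * r ^+ 4 + 4 / 3 * b ^+ 2 * (b + r) ^+ 2) / b ^+ 2.
    by field; rewrite gt_eqF.
  rewrite ler_pdivrMr ?exprn_gt0 //.
  (* r ^ 2 <= 3 r b - 2 b ^ 2 since r lies between b and 2 b *)
  have q : 0 <= (2 * b - r) * (r - b) by rewrite mulr_ge0 ?subr_ge0.
  have q1 := mulr_ge0 q (sqr_ge0 r).
  have q2 := mulr_ge0 q (mulr_ge0 r0 (ltW b0)).
  have q3 := mulr_ge0 q (sqr_ge0 b).
  have b3r : b ^+ 4 <= r * b ^+ 3.
    by rewrite [b ^+ 4]exprS ler_wpM2r ?exprn_ge0 ?(ltW b0).
  have b3 : 0 <= r * b ^+ 3 by rewrite mulr_ge0 ?exprn_ge0 ?(ltW b0).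
  have b22 : 0 <= r ^+ 2 * b ^+ 2 by rewrite mulr_ge0 ?sqr_ge0.
  by lra.
pose y := Num.sqrt (x ^+ 2 / 3); have x0 : 0 <= x ^+ 2 by apply: sqr_ge0.
have y0 : 0 <= y by apply: sqrtr_ge0.
have y2 : y ^+ 2 = x ^+ 2 / 3 by rewrite sqr_sqrtr //; lra.
have yb : b <= y by rewrite -ler_sqr ?nnegrE ?(ltW b0) // y2; lra.
exists y => //=; have -> : x ^+ 2 = 3 * y ^+ 2 by lra.
have -> : Num.sqrt (3 * y ^+ 2 + y ^+ 2) = 2 * y.
  have -> : 3 * y ^+ 2 + y ^+ 2 = (2 * y) ^+ 2 by ring.
  by rewrite sqrtr_sqr ger0_norm ?mulr_ge0.
have -> : (3 * y ^+ 2 + y ^+ 2) / y = 4 * y.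
  by field; rewrite gt_eqF // (lt_le_trans b0).
by have := sqr_ge0 b; have := sqr_ge0 y; split; lra.
Qed.

Variables (n : nat) (p : mpoly n R[i]).
Hypotheses (p_stable : stable p) (p0 : peval p 0 = 1).

Let G := l2norm (gradient p 0).
Let K := G ^+ 2 + opnorm (remx (hessian p 0)).
Let Pj j := peval (mderiv j p) 0.

Lemma gradient_part_le (x v : 'I_n -> R) :
  \sum_j (Re (Pj j) * x j - Im (Pj j) * v j) <=
  G * rnorm (fun j => Num.sqrt (x j ^+ 2 + v j ^+ 2)).
Proof.
have G' : G = rnorm (fun j => Num.sqrt (cabs2 (Pj j))).
  by rewrite /G l2normE; congr Num.sqrt; apply: eq_bigr => j _; rewrite mxE normc_cabs2.
rewrite G'; apply: le_trans (le_trans (ler_norm _) (cauchy_schwarz _ _)).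
apply: ler_sum => j _; apply: le_trans (ler_norm _) _.
rewrite -ler_sqr ?nnegrE ?mulr_ge0 ?sqrtr_ge0 // real_normK ?num_real //.
rewrite exprMn !sqr_sqrtr ?cabs2_ge0 ?addr_ge0 ?sqr_ge0 // /cabs2.
by have := sqr_ge0 (Re (Pj j) * v j + Im (Pj j) * x j); lra.
Qed.

(** The form splits into a product of two gradient terms and the real
    part of the Hessian, which acts on the vector v seen in C^n. *)
Lemma hessian_part_le (u v : 'I_n -> R) :
  \sum_j (\sum_k u k * re_log_hessian p j k) * v j <= K * (rnorm u * rnorm v).
Proof.
have dotle (a : 'I_n -> R) : `|\sum_j Re (Pj j) * a j| <= G * rnorm a.
  apply: le_trans (cauchy_schwarz _ _) _; rewrite ler_wpM2r ?rnorm_ge0 //.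
  rewrite /G l2normE ler_wsqrtr // ler_sum // => j _.
  by rewrite normc_sqr mxE /cabs2 lerDl sqr_ge0.
pose V : 'cV[R[i]]_n := \col_j real_complex R (v j).
have Vn : l2norm V = rnorm v.
  rewrite l2normE; congr Num.sqrt; apply: eq_bigr => j _.
  by rewrite mxE normc_sqr /cabs2 /= expr0n addr0.
pose h k := Re ((remx (hessian p 0) *m V) k 0).
have hE k : h k = \sum_j Re (peval (mderiv k (mderiv j p)) 0) * v j.
  rewrite /h mxE Re_sum; apply: eq_bigr => j _.
  by rewrite !mxE !cE /= mulr0 subr0.
have hle : rnorm h <= opnorm (remx (hessian p 0)) * rnorm v.
  rewrite -Vn; apply: le_trans (l2norm_mulmx_le _ _).
  rewrite l2normE ler_wsqrtr // ler_sum // => j _.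
  by rewrite normc_sqr /cabs2 lerDl sqr_ge0.
have -> : \sum_j (\sum_k u k * re_log_hessian p j k) * v j =
   (\sum_j Re (Pj j) * v j) * (\sum_k Re (Pj k) * u k) - \sum_k u k * h k.
  have expand j k : u k * re_log_hessian p j k * v j =
     Re (Pj j) * v j * (Re (Pj k) * u k) -
     u k * (Re (peval (mderiv k (mderiv j p)) 0) * v j).
    by rewrite /re_log_hessian -/(Pj j) -/(Pj k); ring.
  under eq_bigr => j _.
    rewrite mulr_suml; under eq_bigr => k _ do rewrite expand.
    rewrite sumrB -mulr_sumr; over.
  rewrite sumrB -mulr_suml; congr (_ - _); rewrite exchange_big /=.
  by apply: eq_bigr => k _; rewrite hE mulr_sumr.
apply: le_trans (ler_norm _) _; apply: le_trans (ler_normB _ _) _.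
rewrite normrM /K mulrDl lerD //.
  rewrite expr2 [rnorm u * _]mulrC mulrACA.
  by rewrite ler_pM ?normr_ge0.
apply: le_trans (cauchy_schwarz _ _) _.
by rewrite mulrCA ler_wpM2l ?rnorm_ge0.
Qed.

Lemma quadratic_coef_ge0 : 0 <= K.
Proof. by rewrite addr_ge0 ?sqr_ge0 ?opnorm_ge0. Qed.

(** Each b j has to be positive because [stable_cabs2_bound] needs a point with
    strictly positive imaginary parts, even where z has a zero coordinate. *)
Lemma stable_normc_bound (z : 'cV[R[i]]_n) (b : 'I_n -> R) (rho : R) :
    (forall j, 0 < b j) -> (forall j, `|Im (z j 0)| <= b j) ->
    0 <= rho -> rho ^+ 2 = \sum_j (Re (z j 0) ^+ 2 + b j ^+ 2) ->
  Normc.normc (peval p z) <= expR (Num.sqrt 2 * G * rho + K * rho ^+ 2).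
Proof.
move=> b0 zb rho0 rho2.
have /fin_all_exists2[y yb yP] := fun j => elevation_exists (Re (z j 0)) (b0 j).
pose w : 'cV[R[i]]_n := \col_j Complex (Re (z j 0)) (y j).
have w_upper : upper w by move=> j; rewrite mxE /= (lt_le_trans (b0 j)).
have zw : cabs2 (peval p z) <= cabs2 (peval p w).
  apply: stable_cabs2_le => // j; rewrite mxE //=.
  exact: le_trans (zb j) (yb j).
pose v j := y j + Num.sqrt (Re (z j 0) ^+ 2 + y j ^+ 2).
pose u := mobius_slope w.
have uv : rnorm u * rnorm v <= 4 * rho ^+ 2.
  have : 3 / 4 * rnorm u ^+ 2 + 4 / 3 * rnorm v ^+ 2 <= 8 * rho ^+ 2.
    rewrite !rnorm_sqr rho2 !mulr_sumr -big_split /=; apply: ler_sum => j _.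
    by have [le _] := yP j; rewrite /u /mobius_slope /cabs2 !mxE.
  have := sqr_ge0 (3 / 4 * rnorm u - rnorm v); lra.
have xv : rnorm (fun j => Num.sqrt (Re (z j 0) ^+ 2 + (v j / 2) ^+ 2)) <=
          Num.sqrt 2 * rho.
  rewrite -[rho]ger0_norm // -sqrtr_sqr -sqrtrM // ler_wsqrtr // rho2 mulr_sumr ler_sum // => j _.
  by rewrite sqr_sqrtr ?addr_ge0 ?sqr_ge0 //; have [_] := yP j.
have := stable_cabs2_bound p_stable p0 w_upper.
move=> /(le_trans zw) le.
rewrite normc_cabs2 -ler_sqr ?nnegrE ?sqrtr_ge0 ?expR_ge0 //.
rewrite sqr_sqrtr ?cabs2_ge0 // -expRM_natl; apply: le_trans le _; rewrite ler_expR.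
have := gradient_part_le (fun j => Re (z j 0)) (fun j => v j / 2).
have := hessian_part_le u v.
set A := \sum_j (\sum_k _) * _; set B := \sum_j (_ - _) => AK BG.
have -> : \sum_j (Re (Pj j) * Re (w j 0) - Im (Pj j) *
     (Im (w j 0) + Num.sqrt (cabs2 (w j 0))) / 2) = B.
  by apply: eq_bigr => j _; rewrite !mxE /= mulrA.
have -> : \sum_j (\sum_k mobius_slope w k * re_log_hessian p j k) *
     (Im (w j 0) + Num.sqrt (cabs2 (w j 0))) / 2 = A / 2.
  by rewrite mulr_suml; apply: eq_bigr => j _; rewrite !mxE /=.
have G0 : 0 <= G by apply: l2norm_ge0.
have := ler_wpM2l G0 xv; have := ler_wpM2l quadratic_coef_ge0 uv; lra.
Qed.

End EuclideanBound.

(** * Letting the elevation tend to zero *)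

Lemma le_expR_right_limit (R : realType) (A g K r : R) :
    0 <= g -> 0 <= K -> 0 <= r ->
    (forall d, 0 < d -> A <= expR (g * (r + d) + K * (r + d) ^+ 2)) ->
  A <= expR (g * r + K * r ^+ 2).
Proof.
move=> g0 K0 r0 AE; have [A0|A0] := leP A 0.
  exact: le_trans A0 (expR_ge0 _).
rewrite -[A]lnK ?posrE // ler_expR; apply/ler_addgt0Pr => e e0.
pose C := g + K * (2 * r + 1) + 1.
have C0 : 0 < C by rewrite ltr_wpDl // addr_ge0 // mulr_ge0 // addr_ge0 ?mulr_ge0.
pose d := Num.min 1 (e / C).
have d0 : 0 < d by rewrite lt_min ltr01 divr_gt0.
have d1 : d <= 1 by rewrite ge_min lexx.
have dC : d * C <= e by rewrite -ler_pdivlMr // ge_min lexx orbT.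
have := AE d d0; rewrite -[A]lnK ?posrE // ler_expR lnK ?posrE // => /le_trans; apply.
have Kd : 0 <= K * (d * (1 - d)) by rewrite !mulr_ge0 ?subr_ge0 // ltW.
by move: dC; rewrite /C; lra.
Qed.

Theorem theorem1p5 (R : realType) (n : nat) (p : mpoly.mpoly n R[i]) :
  stable p -> peval p 0 = 1 ->
  forall z : 'cV[R[i]]_n,
    Normc.normc (peval p z) <=
      expR (Num.sqrt 2 * l2norm (gradient p 0) * l2norm z
            + (l2norm (gradient p 0) ^+ 2 + opnorm (remx (hessian p 0)))
              * l2norm z ^+ 2).
Proof.
move=> p_stable p0 z; set G := l2norm _; set K := _ ^+ 2 + opnorm _.
set r := l2norm z.
have G0 : 0 <= Num.sqrt 2 * G by rewrite mulr_ge0 ?sqrtr_ge0 ?l2norm_ge0.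
have K0 : 0 <= K := quadratic_coef_ge0 p.
have r0 : 0 <= r := l2norm_ge0 z.
apply: le_expR_right_limit => // d d0.
(* Raising each of the n coordinates by e moves |z| by at most n e <= d. *)
pose e := d / n.+1%:R; have e0 : 0 < e by rewrite divr_gt0 ?ltr0n.
have ne : n%:R * e <= d.
  by rewrite mulrCA ler_piMr ?(ltW d0) // ler_pdivrMr ?ltr0n // mul1r ler_nat.
have ed : e <= d by rewrite ler_piMr ?(ltW d0) // invf_le1 ?ltr0n // ler1n.
pose b j := `|Im (z j 0)| + e.
pose rho := Num.sqrt (\sum_j (Re (z j 0) ^+ 2 + b j ^+ 2)).
have b0 j : 0 < b j by rewrite ltr_wpDl.
have rho0 : 0 <= rho by apply: sqrtr_ge0.
have rho2 : rho ^+ 2 = \sum_j (Re (z j 0) ^+ 2 + b j ^+ 2).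
  by rewrite sqr_sqrtr // sumr_ge0 // => j _; rewrite addr_ge0 ?sqr_ge0.
have zb j : `|Im (z j 0)| <= b j by rewrite lerDl ltW.
apply: le_trans (stable_normc_bound p_stable p0 b0 zb rho0 rho2) _.
have rd : rho <= r + d.
  rewrite -ler_sqr ?nnegrE ?addr_ge0 ?(ltW d0) // rho2.
  apply: (@le_trans _ _ (\sum_(j < n) (cabs2 (z j 0) + e * (2 * r + e)))).
    apply: ler_sum => j _; rewrite /cabs2 /b -[Im _ ^+ 2]real_normK ?num_real //.
    have : `|Im (z j 0)| <= r.
      apply: le_trans (ler_rnorm (fun j => Normc.normc (z j 0)) j).
      rewrite [leRHS]ger0_norm ?normc_ge0 // normc_cabs2 -sqrtr_sqr.
      by rewrite ler_wsqrtr // lerDr sqr_ge0.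
    by move=> /(ler_wpM2l (ltW e0)); lra.
  rewrite big_split /= -l2norm_sqr sumr_const card_ord -[_ *+ n]mulr_natl mulrA.
  have : n%:R * e * (2 * r + e) <= d * (2 * r + d).
    apply: ler_pM; [| |exact: ne|by rewrite lerD2l].
      by rewrite mulr_ge0 ?ler0n ?ltW.
    by rewrite addr_ge0 ?(ltW e0) // mulr_ge0.
  by rewrite -/r; lra.
rewrite ler_expR -/K -/G lerD //; first by rewrite ler_wpM2l.
by rewrite ler_wpM2l // lerXn2r ?nnegrE ?addr_ge0 ?(ltW d0).
Qed.
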